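(* Let $\{\pi_n\}_{n\ge 1}$ be a dense sequence of partitions of $[0,1]$. Then there exists a sequence of partitions $\{\sigma_n\}_{n\ge 1}$ of $[0,1]$, with $\sigma_n\in \pi_n!$ for every $n$, which is uniformly distributed.
   Context: A partition of $[0,1]$ is a finite collection of intervals $\pi=\{[t_{i-1},t_i] : 1\le i\le k\}$ with $0=t_0<t_1<\dots<t_k=1$. Write $l_i=t_i-t_{i-1}$ for the length of its $i$-th interval. The diameter of $\pi$ is $\operatorname{diam}\pi=\max_{1\le i\le k} l_i$. A sequence of partitions $\{\pi_n\}$ is called dense if $\lim_{n\to\infty}\operatorname{diam}\pi_n=0$. A permutation of the partition $\pi=\{[t_{i-1},t_i]:1\le i\le k\}$ is a partition $\pi'=\{[s_{h-1},s_h]:1\le h\le k\}$ defined by the points $s_0=0$ and $s_h=\sum_{j=1}^{h} l_{i_j}$ for $1\le h\le k$, where $(i_1,\dots,i_k)$ is a permutation of the indices $\{1,2,\dots,k\}$ (that is, the intervals of $\pi$ are rearranged in another order). The set of all permutations of $\pi$ is denoted $\pi!$. A sequence of partitions $\{\pi_n\}$ of $[0,1]$, with $\pi_n=\{[t_{i-1}^n,t_i^n]:1\le i\le k(n)\}$, is called uniformly distributed if for every continuous function $f$ on $[0,1]$ $$\lim_{n\to\infty}\frac{1}{k(n)}\sum_{i=1}^{k(n)} f(t_i^n)=\int_0^1 f(t)\,dt.$$ *)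

(* Defs.v *)
From HB Require Import structures.
From mathcomp Require Import all_boot all_order all_algebra all_fingroup.
From mathcomp Require Import all_classical all_reals all_analysis.

Set Implicit Arguments.
Unset Strict Implicit.
Unset Printing Implicit Defensive.

Import Order.TTheory GRing.Theory Num.Theory.
Import numFieldNormedType.Exports.

Local Open Scope classical_set_scope.
Local Open Scope ring_scope.

(* As in the library's [itv_partition 0 1 s], a partition
   0 = t_0 < t_1 < ... < t_k = 1 is represented by the sequence
   s = [:: t_1; ...; t_k] of its points without t_0; it has k = size s
   intervals. *)

(* Indices are shifted by one: this is l_(i+1) = t_(i+1) - t_i, 0 <= i < k. *)
Definition part_length (R : realType) (s : seq R) (i : nat) : R :=
  (0 :: s)`_i.+1 - (0 :: s)`_i.

(* The lengths are positive, so the neutral element 0 does not affect the max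
   of a partition. *)
Definition diam (R : realType) (s : seq R) : R :=
  \big[Num.max/0]_(i < size s) part_length s i.

Definition dense_partitions (R : realType) (s_ : nat -> seq R) : Prop :=
  diam (s_ n) @[n --> \oo] --> (0 : R).

(* The partition whose h-th interval (0 <= h < k) has the length of the
   (p h)-th interval of s. *)
Definition permute_partition (R : realType) (s : seq R) (p : 'S_(size s)) :
    seq R :=
  mkseq (fun h => \sum_(j < size s | (j <= h)%N) part_length s (p j)) (size s).

(* The set written s! in the mathematical notation. *)
Definition partition_perms (R : realType) (s : seq R) : set (seq R) :=
  range (@permute_partition R s).

Definition uniformly_distributed (R : realType) (s_ : nat -> seq R) : Prop :=
  forall f : R -> R, {within `[0, 1], continuous f} ->
    ((size (s_ n))%:R^-1 * \sum_(i < size (s_ n)) f (s_ n)`_i) @[n --> \oo] -->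
      \int[@lebesgue_measure R]_(t in `[0, 1]) f t.

(* Main.v *)
(* Write l_1, ..., l_k for the lengths of a partition and d for its diameter, so
   that 1/k <= d.  The numbers l_i - 1/k add up to 0 and are bounded by d, so
   they can be arranged greedily, taking a nonnegative one whenever the current
   partial sum is nonpositive and vice versa, in such a way that all partial
   sums stay in [-d, d].  The corresponding permutation of the partition
   satisfies |s_h - h/k| <= d for all h, so the mean of the f(s_h) is close to
   the Riemann sum of f for the regular partition, by uniform continuity. *)
Require Import Defs.
From mathcomp Require Import all_boot all_order all_algebra all_fingroup.
From mathcomp Require Import all_classical all_reals all_analysis.
From mathcomp Require Import lra.

Set Implicit Arguments.
Unset Strict Implicit.
Unset Printing Implicit Defensive.

Import Order.TTheory GRing.Theory Num.Theory.
Import numFieldNormedType.Exports.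

Local Open Scope classical_set_scope.
Local Open Scope ring_scope.

(** The starting value [a] makes the induction on the size of [s] work: a chosen term is removed
    from [s] and absorbed into [a], which keeps the total 0. *)
Lemma bounded_partial_sums_seq (R : realDomainType) (I : eqType) (v : I -> R)
    (d : R) (s : seq I) (a : R) :
  `|a| <= d -> {in s, forall i, `|v i| <= d} -> a + \sum_(i <- s) v i = 0 ->
  exists2 s' : seq I, perm_eq s' s &
    forall m, `|a + \sum_(i <- take m s') v i| <= d.
Proof.
move: {2}(size s) (erefl (size s)) => n.
elim: n s a => [|n IHn] s a sn ad vd sum0.
  exists s => // m; move: sn => /eqP /nilP ->.
  by rewrite /= big_nil addr0.
(* A term of sign opposite to [a] moves the partial sum by at most [d] towards 0 or past it. Without
   such a term the total could not be 0. *)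
have [x xs xd] : exists2 x, x \in s & `|a + v x| <= d.
  have [a0|a0] := leP a 0.
    have [|] := boolP (has (fun i => 0 <= v i) s).
      move=> /hasP[x xs vx]; exists x => //.
      by have := vd _ xs; move: ad; rewrite !ler_norml; lra.
    move=> /hasPn vneg; exfalso.
    (* As [a] may be 0 here, strict negativity of the total has to come from the first term of the
       nonempty [s]. *)
    case: s sn vd sum0 vneg => // y s _ _; rewrite big_cons => sum0 vneg.
    have := vneg y (mem_head _ _); rewrite -ltNge => vy.
    have : \sum_(i <- s) v i <= 0.
      rewrite big_seq sumr_le0// => i si.
      by apply: ltW; rewrite ltNge vneg// inE si orbT.
    by move: sum0; lra.
  have [|] := boolP (has (fun i => v i <= 0) s).
    move=> /hasP[x xs vx]; exists x => //.
    by have := vd _ xs; move: ad; rewrite !ler_norml; lra.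
  move=> /hasPn vpos; exfalso.
  have : 0 <= \sum_(i <- s) v i.
    rewrite big_seq sumr_ge0// => i si.
    by apply: ltW; rewrite ltNge vpos.
  by move: sum0; lra.
have ps := perm_to_rem xs.
have [||||s' ps' s'd] := IHn (rem x s) (a + v x).
- by rewrite size_rem// sn.
- exact: xd.
- by move=> i /mem_rem; exact: vd.
- by rewrite -addrA -[RHS]sum0 (perm_big _ ps) big_cons.
exists (x :: s').
  by rewrite perm_sym (perm_trans ps)// perm_cons perm_sym.
by case=> [|m] /=; rewrite ?big_nil ?addr0// big_cons addrA.
Qed.

Lemma bounded_partial_sums_perm (R : realDomainType) (k : nat) (v : 'I_k -> R)
    (d : R) :
  (forall i, `|v i| <= d) -> \sum_i v i = 0 ->
  exists p : 'S_k, forall h : 'I_k, `|\sum_(j < k | (j <= h)%N) v (p j)| <= d.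
Proof.
(* For [k = 0] the bound [0 <= d] may fail, but there is no [h] to check. *)
case: k v => [|k] v vd sum0; first by exists 1%g => -[].
have d0 : 0 <= d := le_trans (normr_ge0 _) (vd ord0).
have [|||s ps sd] := @bounded_partial_sums_seq R _ v d (index_enum 'I_k.+1) 0.
- by rewrite normr0.
- by move=> i _.
- by rewrite add0r.
have sz : size s = k.+1.
  by rewrite (perm_size ps) /index_enum -enumT size_enum_ord.
have us : uniq s by rewrite (perm_uniq ps) index_enum_uniq.
(* The rearranged list of indices has no repetition, so reading off its entries is a permutation. *)
have inj : injective (fun j : 'I_k.+1 => nth ord0 s j).
  move=> i j /eqP; rewrite nth_uniq ?sz// => /eqP; exact: val_inj.
exists (perm inj) => h; have := sd h.+1; rewrite add0r.
rewrite (big_nth ord0) size_takel ?sz ?ltn_ord// big_mkord.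
rewrite (big_ord_widen _ (fun i => v (nth ord0 (take h.+1 s) i)) (ltn_ord h)).
congr (`| _ | <= _); apply: eq_big => // i ih.
by rewrite permE nth_take.
Qed.

Lemma part_length_gt0 (R : realType) (s : seq R) (i : nat) :
  itv_partition 0 1 s -> (i < size s)%N -> 0 < part_length s i.
Proof.
by move=> [/(pathP 0) sP _] /sP si; rewrite /part_length subr_gt0.
Qed.

Lemma sum_part_length (R : realType) (s : seq R) :
  itv_partition 0 1 s -> \sum_(i < size s) part_length s i = 1.
Proof.
move=> hs; rewrite -(big_mkord predT (part_length s)) /part_length.
rewrite telescope_sumr// subr0.
by rewrite (itv_partition_nth_size 0 hs).
Qed.

Lemma size_itv_partition01_gt0 (R : realType) (s : seq R) :
  itv_partition 0 1 s -> (0 < size s)%N.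
Proof.
case: s => // /itv_partition_nil /eqP.
by rewrite eq_sym oner_eq0.
Qed.

Lemma part_length_le_diam (R : realType) (s : seq R) (i : 'I_(size s)) :
  part_length s i <= diam s.
Proof. exact: (le_bigmax _ (fun j : 'I_(size s) => part_length s j)). Qed.

Lemma itv_partition_nth_itvcc (R : realType) (a b : R) (s : seq R) (i : nat) :
  itv_partition a b s -> (i < size s)%N -> a <= s`_i <= b.
Proof.
move=> hs si; rewrite (set_nth_default b)//.
by rewrite (@itv_partition_nth_ge _ _ _ _ _ i.+1 _ hs)//
  (@itv_partition_nth_le _ _ _ _ _ i.+1 _ hs).
Qed.

(** The lengths add up to 1, so their mean [1/k] is at most their maximum. *)
Lemma invr_size_le_diam (R : realType) (s : seq R) :
  itv_partition 0 1 s -> (size s)%:R^-1 <= diam s.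
Proof.
move=> hs; have k0 := size_itv_partition01_gt0 hs.
rewrite -[leLHS]mul1r ler_pdivrMr ?ltr0n// -[leLHS](sum_part_length hs).
rewrite mulr_natr -[in leRHS](card_ord (size s)) -sumr_const ler_sum// => i _.
exact: part_length_le_diam.
Qed.

Lemma size_permute_partition (R : realType) (s : seq R) (p : 'S_(size s)) :
  size (permute_partition p) = size s.
Proof. exact: size_mkseq. Qed.

Lemma nth_permute_partition (R : realType) (s : seq R) (p : 'S_(size s)) h :
  (h < size s)%N ->
  (permute_partition p)`_h = \sum_(j < size s | (j <= h)%N) part_length s (p j).
Proof. by move=> hs; rewrite nth_mkseq. Qed.

Lemma itv_partition_permute (R : realType) (s : seq R) (p : 'S_(size s)) :
  itv_partition 0 1 s -> itv_partition 0 1 (permute_partition p).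
Proof.
move=> hs; have k0 := size_itv_partition01_gt0 hs; split.
  apply/(pathP 0) => i; rewrite size_permute_partition => ik.
  rewrite [ltRHS]nth_permute_partition// (bigD1 (Ordinal ik))//=.
  (* Without its last length, the sum is the preceding point; the prepended 0 covers [i = 0]. *)
  rewrite [X in _ < _ + X](_ : _ = (0 :: permute_partition p)`_i).
    by rewrite ltrDr part_length_gt0.
  case: i ik => [|i] ik /=.
    rewrite big1// => j /andP[]; rewrite leqn0 => /eqP j0 /eqP[].
    exact: val_inj.
  rewrite nth_permute_partition ?(ltnW ik)//; apply: eq_bigl => j.
  by rewrite -val_eqE/= andbC -ltn_neqAle ltnS.
rewrite (last_nth 0) size_permute_partition.
rewrite -(prednK k0) /= nth_permute_partition ?prednK//.
rewrite (eq_bigl predT) => [|j]; last by rewrite -ltnS prednK// ltn_ord.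
rewrite -(reindex_inj (@perm_inj _ p) (P := predT)
  (F := fun i : 'I_(size s) => part_length s i)).
by rewrite sum_part_length.
Qed.

Lemma exists_equidistant_permutation (R : realType) (s : seq R) :
  itv_partition 0 1 s ->
  exists t, [/\ itv_partition 0 1 t, partition_perms s t, size t = size s &
    forall h, (h < size s)%N -> `|t`_h - h.+1%:R / (size s)%:R| <= diam s].
Proof.
move=> hs; have k0 := size_itv_partition01_gt0 hs.
pose v (i : 'I_(size s)) := part_length s i - (size s)%:R^-1.
have [||p pd] := @bounded_partial_sums_perm R _ v (diam s).
(* Both the length and [1/k] lie between 0 and the diameter. *)
- move=> i; rewrite /v ler_norml.
  have := part_length_gt0 hs (ltn_ord i); have := part_length_le_diam i.
  have := invr_size_le_diam hs.
  have : 0 < (size s)%:R^-1 :> R by rewrite invr_gt0 ltr0n.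
  by lra.
- rewrite sumrB sum_part_length// sumr_const card_ord -[X in _ - X]mulr_natr.
  by rewrite mulVf ?subrr// pnatr_eq0 -lt0n.
exists (permute_partition p); split.
- exact: itv_partition_permute.
- by exists p.
- exact: size_permute_partition.
move=> h hk; have := pd (Ordinal hk); rewrite sumrB nth_permute_partition//.
have -> : \sum_(j < size s | (j <= h)%N) (size s)%:R^-1 =
    h.+1%:R / (size s)%:R :> R.
  by rewrite -(big_ord_widen _ (fun=> _) hk) sumr_const card_ord mulr_natl.
exact.
Qed.

(** Heine-Cantor. With [d] ranging over a filter, the near-covering form of compactness reduces the
    claim to points [x'] near a fixed [x] and small [d]. *)
Lemma compact_unif_continuous (R : realType) (K : set R) (f : R -> R) (e : R) :
  compact K -> {within K, continuous f} -> 0 < e ->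
  \forall d \near 0^'+,
    forall x y, K x -> K y -> `|x - y| < d -> `|f x - f y| < e.
Proof.
move=> /compact_near_coveringP/near_covering_withinP cK cf e0.
pose P (d x : R) := forall y, K y -> `|x - y| < d -> `|f x - f y| < e.
suff : \forall d \near 0^'+, K `<=` P d.
  by apply: filterS => d KP x y Kx Ky; exact: KP.
apply: cK => x Kx.
have /cvgrPdist_lt /(_ (e / 2)) : f @ within K (nbhs x) --> f x.
  by move/subspace_continuousP : cf; exact.
rewrite divr_gt0// => /(_ isT); rewrite near_withinE.
move=> /nbhs_ballP[r /= r0 fr].
(* Halving [r] places both [x'] and [y] within [r] of [x], so each value is within [e / 2] of
   [f x]. *)
near=> x' d => /= Kx' y Ky x'y.
have xx' : `|x - x'| < r / 2.
  by near: x'; apply: (@cvgr_dist_lt _ _ _ (nbhs x) _ id x); rewrite ?divr_gt0.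
have dr : d < r / 2 by near: d; apply: nbhs_right_lt; rewrite divr_gt0.
have h1 : `|f x - f x'| < e / 2 by apply: fr => //=; rewrite /ball/=; lra.
have h2 : `|f x - f y| < e / 2.
  apply: fr => //=; rewrite /ball/=.
  by have := ler_distD x' x y; lra.
by have := ler_distD (f x) (f x') (f y); rewrite (distrC (f x') (f x)); lra.
Unshelve. all: by end_near. Qed.

(** The integrals over [[0, i/k]] telescope; their differences are integrals over half-open
    cells. *)
Lemma Rintegral_regular_split (R : realType) (f : R -> R) (k : nat) :
  (0 < k)%N -> (@lebesgue_measure R).-integrable `[0, 1] (EFin \o f) ->
  \int[lebesgue_measure]_(t in `[0, 1]) f t =
  \sum_(i < k) \int[lebesgue_measure]_(t in `]i%:R / k%:R, i.+1%:R / k%:R]) f t.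
Proof.
move=> k0 intf.
pose F (i : nat) := \int[lebesgue_measure]_(t in `[0, i%:R / k%:R]) f t.
have kp : 0 < k%:R^-1 :> R by rewrite invr_gt0 ltr0n.
transitivity (F k - F 0).
  rewrite /F mul0r set_itv1 Rintegral_set1 subr0 divff//.
  by rewrite pnatr_eq0 -lt0n.
rewrite -telescope_sumr// big_mkord; apply: eq_bigr => i _.
rewrite /F Rintegral_itvB ?bnd_simp ?ler_wpM2r ?ler_nat ?mulr_ge0 ?(ltW kp)//.
apply: integrableS intf => //; apply: subset_itvl; rewrite bnd_simp.
by rewrite ler_pdivrMr ?ltr0n// mul1r ler_nat.
Qed.

(** Each term of the mean is the integral of a constant over a cell of measure [1/k], so the error
    splits into one integral per cell, each at most [e / k]. *)
Lemma dist_mean_Rintegral (R : realType) (f : R -> R) (s : seq R) (e : R) :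
  (0 < size s)%N -> (@lebesgue_measure R).-integrable `[0, 1] (EFin \o f) ->
  (forall i t, (i < size s)%N ->
    i%:R / (size s)%:R < t <= i.+1%:R / (size s)%:R -> `|f s`_i - f t| <= e) ->
  `|(size s)%:R^-1 * \sum_(i < size s) f s`_i -
    \int[lebesgue_measure]_(t in `[0, 1]) f t| <= e.
Proof.
move=> k0 intf fe; set k := size s.
have kp : 0 < k%:R^-1 :> R by rewrite invr_gt0 ltr0n.
rewrite (@Rintegral_regular_split _ _ k)// mulr_sumr -sumrB.
apply: le_trans (ler_norm_sum _ _ _) _.
have -> : e = \sum_(i < k) e * k%:R^-1.
  by rewrite sumr_const card_ord -[RHS]mulr_natr mulfVK// pnatr_eq0 -lt0n.
apply: ler_sum => i _.
set D := `]_, _]%classic.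
have muD : fine (lebesgue_measure D) = k%:R^-1.
  rewrite /D lebesgue_measure_itv/= lte_fin ltr_pM2r// ltr_nat ltnSn.
  by rewrite /= -mulrBl -natrB// subSnn mul1r.
have mD : measurable (D : set (measurableTypeR R)) by exact: measurable_itv.
have D01 : D `<=` `[0, 1].
  apply: subset_itvScc; rewrite bnd_simp; first by rewrite mulr_ge0// ltW.
  by rewrite ler_pdivrMr ?ltr0n// mul1r ler_nat.
have iD : (@lebesgue_measure R).-integrable D (EFin \o f).
  exact: integrableS intf.
have icst c : (@lebesgue_measure R).-integrable D (EFin \o cst c).
  have : (@lebesgue_measure R).-integrable `[0, 1] (EFin \o cst c);
    last exact: integrableS.
  apply: continuous_compact_integrable; first exact: segment_compact.
  by apply: continuous_subspaceT => x; exact: cst_continuous.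
(* Reading [1/k] as the measure of [D] puts both terms under one integral. *)
rewrite -[X in X * f _]muD mulrC -Rintegral_cst// -RintegralB//;
  last exact: icst.
have iB : (@lebesgue_measure R).-integrable D (EFin \o (fun t => f s`_i - f t)).
  by have := integrableB mD (icst (f s`_i)) iD; apply: eq_integrable.
apply: le_trans (le_normr_Rintegral mD iB) _.
rewrite -[X in _ <= _ * X]muD -Rintegral_cst//; apply: le_Rintegral => //.
- exact: integrable_norm.
- exact: icst.
- by move=> t; rewrite /D /= in_itv; exact: fe.
Qed.

Theorem theorem2p2 (R : realType) (pi_ : nat -> seq R)
    (hpart : forall n, itv_partition 0 1 (pi_ n))
    (hdense : dense_partitions pi_) :
  exists sigma_ : nat -> seq R,
    [/\ forall n, itv_partition 0 1 (sigma_ n),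
        forall n, partition_perms (pi_ n) (sigma_ n) &
        uniformly_distributed sigma_].
Proof.
have [t tP] := choice (fun n => exists_equidistant_permutation (hpart n)).
exists t; split; [by move=> n; case: (tP n)..|move=> f cf].
have cK := @segment_compact R 0 1.
have intf := continuous_compact_integrable cK cf.
apply/cvgrPdist_le => e e0.
have [d d0 fd] : exists2 d, 0 < d & forall x y, `[0, 1]%classic x ->
    `[0, 1]%classic y -> `|x - y| < d -> `|f x - f y| < e.
  near (0 : R)^'+ => d; exists d => //.
  by near: d; exact: compact_unif_continuous.
(* The distance from a point of cell [i] to the entry [i] of [t n] is at most the sum of two errors:
   [1/k] to reach [(i+1)/k], then the bound on the permuted partition. Each is at most the diameter,
   hence below [d / 2]. *)
move/cvgrPdist_lt : hdense => /(_ (d / 2)); rewrite divr_gt0// => /(_ isT).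
apply: filterS => n; rewrite sub0r normrN => /(le_lt_trans (ler_norm _)) dn.
have [ht _ st td] := tP n; have k0 := size_itv_partition01_gt0 ht.
rewrite distrC; apply: dist_mean_Rintegral => // i x it.
move: (it); rewrite st => ik /andP[ix xi].
have kp : 0 < (size (pi_ n))%:R^-1 :> R by rewrite invr_gt0 ltr0n -st.
have kd := invr_size_le_diam (hpart n).
have iS : i.+1%:R / (size (pi_ n))%:R =
    i%:R / (size (pi_ n))%:R + (size (pi_ n))%:R^-1 :> R.
  by rewrite -natr1 mulrDl mul1r.
apply/ltW/fd => /=.
- by rewrite in_itv/= itv_partition_nth_itvcc.
- rewrite in_itv/=; apply/andP; split.
    by apply: le_trans (ltW ix); rewrite mulr_ge0// ltW.
  by apply: le_trans xi _; rewrite -st ler_pdivrMr ?ltr0n// mul1r ler_nat.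
- have := td _ ik; move: ix xi; rewrite iS ler_norml ltr_norml.
  by lra.
Unshelve. all: by end_near. Qed.
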